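(* Let $\{\pi^k\}_{k\ge0}$ be generated by softmax natural policy gradient (softmax NPG) with any constant step size $\eta>0$, and let $\varepsilon\in(0,\Delta/2)$. Then for all $k\ge0$, $$\|V^*-V^k\|_\infty\le\|V^*-V^0\|_\infty\prod_{t=0}^{k-1}\left(1-(1-\gamma)\left[1-\frac{1}{1+C^t}\right]\right)\le\|V^*-V^0\|_\infty\left(1-(1-\gamma)\left[1-\frac{1}{1+\inf_tC^t}\right]\right)^k,$$ where $C^t=\min_sC_s^t$ and $$C_s^t=\begin{cases}\pi_s^t(\mathcal{A}_s^t)\left(\exp(\eta\,\Delta_s^t)-1\right)&\text{if }\|V^*-V^t\|_\infty>\varepsilon,\\(1-b_s^t)\left(\exp(\eta(\Delta-\varepsilon))-1\right)&\text{if }\|V^*-V^t\|_\infty\le\varepsilon.\end{cases}$$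
   Context: MDP: a tuple $(\mathcal{S},\mathcal{A},P,r,\gamma)$ with finite state space $\mathcal{S}$, finite action space $\mathcal{A}$, transition probabilities $P(s'|s,a)$, reward $r:\mathcal{S}\times\mathcal{A}\to[0,1]$ and discount factor $\gamma\in[0,1)$. A policy is $\pi=(\pi(\cdot|s))_{s\in\mathcal{S}}$ with each $\pi(\cdot|s)$ a probability distribution on $\mathcal{A}$. Values: $V^\pi(s)=\mathbb{E}[\sum_{t\ge0}\gamma^t r(s_t,a_t)\mid s_0=s,\pi]$, $Q^\pi(s,a)=\mathbb{E}[\sum_{t\ge0}\gamma^t r(s_t,a_t)\mid s_0=s,a_0=a,\pi]$, $A^\pi=Q^\pi-V^\pi$. $V^*,Q^*$ are the optimal values and $A^*(s,a)=Q^*(s,a)-V^*(s)$. For policies $\pi^k$, write $V^k,A^k$ for $V^{\pi^k},A^{\pi^k}$; $\|\cdot\|_\infty$ is the maximum absolute entry over states. Optimal actions and gap: $\mathcal{A}_s^*=\arg\max_aA^*(s,a)$, $b_s^t=\sum_{a\notin\mathcal{A}_s^*}\pi^t(a|s)$, $\tilde{\mathcal S}=\{s:\mathcal{A}_s^*\ne\mathcal{A}\}$ (assumed nonempty, so that the gap is defined), $\Delta=\min_{s\in\tilde{\mathcal S},\,a\notin\mathcal{A}_s^*}|A^*(s,a)|$. Greedy actions at iteration $t$: $\mathcal{A}_s^t=\arg\max_aA^t(s,a)$, $\pi_s^t(\mathcal{A}_s^t)=\sum_{a\in\mathcal{A}_s^t}\pi^t(a|s)$, $\Delta_s^t=\max_aA^t(s,a)-\max_{a'\notin\mathcal{A}_s^t}A^t(s,a')$,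 with the maximum over the empty set read as $-\infty$ (so $\Delta_s^t=+\infty$ if $\mathcal{A}_s^t=\mathcal{A}$, and $1/(1+\infty)=0$). Softmax NPG: start from any policy $\pi^0$ with all entries positive (a softmax policy) and iterate $\pi^{k+1}(a|s)=\dfrac{\pi^k(a|s)\exp(\eta A^k(s,a))}{\sum_{a'}\pi^k(a'|s)\exp(\eta A^k(s,a'))}$. *)

(* Defs.v *)
From HB Require Import structures.
From mathcomp Require Import all_boot all_order all_algebra.
From mathcomp Require Import all_classical all_reals all_analysis.
From mathcomp Require Import ring lra.
Import numFieldNormedType.Exports.
Import Order.TTheory GRing.Theory Num.Theory.

Set Implicit Arguments.
Unset Strict Implicit.
Unset Printing Implicit Defensive.

Local Open Scope classical_set_scope.
Local Open Scope ring_scope.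

Record fdist (R : realType) (T : finType) := FDist {
  fdist_fun :> T -> R;
  fdist_ge0 : forall x, 0 <= fdist_fun x;
  fdist_sum1 : \sum_x fdist_fun x = 1 }.

Section markov_chain_existence.
Context (R : realType) (T : finType).
Implicit Types (mu : fdist R T) (K : T -> fdist R T).

Let cdfn mu (k : nat) : R := \sum_(y | (enum_rank y < k)%N) mu y.

Let cell mu (x : T) (u : R) : bool :=
  cdfn mu (enum_rank x) <= u < cdfn mu (enum_rank x) + mu x.

Let cdfnS mu (x : T) :
  cdfn mu (enum_rank x).+1 = cdfn mu (enum_rank x) + mu x.
Proof.
rewrite /cdfn (bigD1 x) ?leqnn//= addrC; congr (_ + _).
apply: eq_bigl => y; rewrite ltnS [RHS]ltn_neqAle andbC; congr (_ && _).
by rewrite (inj_eq val_inj) (inj_eq enum_rank_inj).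
Qed.

Let cdfn_le mu (j k : nat) : (j <= k)%N -> cdfn mu j <= cdfn mu k.
Proof.
move=> jk; rewrite /cdfn big_mkcond [leRHS]big_mkcond; apply: ler_sum => y _.
case: ltnP => yj; first by rewrite (leq_trans yj jk).
by case: ifP => // _; exact: fdist_ge0.
Qed.

Let cdfn_ge0 mu k : 0 <= cdfn mu k.
Proof. by apply: sumr_ge0 => y _; exact: fdist_ge0. Qed.

Let cdfn_le1 mu k : cdfn mu k <= 1.
Proof.
rewrite -(fdist_sum1 mu) /cdfn big_mkcond; apply: ler_sum => y _.
by case: ifP => // _; exact: fdist_ge0.
Qed.

Let cell_uniq mu u x y : cell mu x u -> cell mu y u -> x = y.
Proof.
move=> /andP[x1 x2] /andP[y1 y2]; apply: enum_rank_inj; apply: val_inj => /=.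
apply/eqP; rewrite eqn_leq; apply/andP; split; rewrite leqNgt; apply/negP => h.
- move: (cdfn_le mu h); rewrite cdfnS => h'.
  by have := lt_le_trans (lt_le_trans y2 h') x1; rewrite ltxx.
- move: (cdfn_le mu h); rewrite cdfnS => h'.
  by have := lt_le_trans (lt_le_trans x2 h') y1; rewrite ltxx.
Qed.

Let cell_ex mu u : 0 <= u < 1 -> exists x, cell mu x u.
Proof.
move=> /andP[u0 u1].
have ex : exists k, u < cdfn mu k.
  exists #|T|; rewrite /cdfn (eq_bigl xpredT) ?fdist_sum1// => y.
  by rewrite ltn_ord.
case: (ex_minnP ex) => -[|k] uk kmin.
  by move: uk; rewrite /cdfn big_pred0 ?ltNge ?u0.
have kT : (k < #|T|)%N.
  rewrite ltnNge; apply/negP => Tk; suff /kmin : u < cdfn mu k by rewrite ltnn.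
  apply: (lt_le_trans uk); rewrite /cdfn big_mkcond [leRHS]big_mkcond.
  apply: ler_sum => y _.
  by rewrite (leq_trans (ltn_ord (enum_rank y)) Tk) ltnS (ltnW (leq_trans _ Tk)).
exists (enum_val (Ordinal kT)); rewrite /cell -cdfnS enum_valK /= uk andbT.
by rewrite leNgt; apply/negP => /kmin; rewrite ltnn.
Qed.

Variable x0 : T.

Let sel mu (u : R) : T := odflt x0 [pick x | cell mu x u].

Let selP mu u x : 0 <= u < 1 -> (sel mu u = x) <-> cell mu x u.
Proof.
move=> u01; rewrite /sel; case: pickP => [y yu|h] /=.
  by split=> [<-//|]; exact: cell_uniq.
by have [y] := cell_ex mu u01; rewrite h.
Qed.

Let Fixpoint walk K mu (u : R) (n : nat) : T :=
  let x := sel mu u in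
  if n is m.+1 then walk K (K x) ((u - cdfn mu (enum_rank x)) / mu x) m else x.

Let walk_itv K n mu (x : nat -> T) : exists lo : R,
  let len := mu (x 0%N) * \prod_(t < n) K (x t) (x t.+1) in
  [/\ 0 <= lo, lo + len <= 1 &
    forall u, 0 <= u < 1 ->
      (forall t, (t <= n)%N -> walk K mu u t = x t) <-> lo <= u < lo + len].
Proof.
elim: n mu x => [|n IHn] mu x.
  exists (cdfn mu (enum_rank (x 0%N))) => /=; rewrite big_ord0 mulr1; split.
  - exact: cdfn_ge0.
  - by rewrite -cdfnS cdfn_le1.
  - move=> u u01; split=> [/(_ 0%N isT)/= /(selP mu _ u01)//|ux t].
    by rewrite leqn0 => /eqP->/=; apply/(selP mu _ u01).
have [lo /= [lo0 lo1 lo_walk]] := IHn (K (x 0%N)) (fun t => x t.+1).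
set len := (X in lo + X) in lo1 lo_walk.
set c := cdfn mu (enum_rank (x 0%N)); set p := mu (x 0%N).
have lenE : p * \prod_(t < n.+1) K (x t) (x t.+1) = p * len.
  by rewrite big_ord_recl.
have len0 : 0 <= len.
  by rewrite mulr_ge0 ?fdist_ge0//; apply: prodr_ge0 => t _; exact: fdist_ge0.
have p0 : 0 <= p by exact: fdist_ge0.
have c0 : 0 <= c by exact: cdfn_ge0.
have cp1 : c + p <= 1 by rewrite -cdfnS cdfn_le1.
exists (c + p * lo) => /=; rewrite lenE; split; first by nra.
  by nra.
move=> u u01.
have [p_eq0|p_neq0] := eqVneq p 0.
  split=> [/(_ 0%N isT)/= /(selP mu _ u01)|].
    by rewrite /cell -/c -/p p_eq0 => /andP[*]; lra.
  by rewrite p_eq0 => /andP[h1 h2]; exfalso; lra.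
have p_gt0 : 0 < p by rewrite lt_neqAle eq_sym p_neq0.
pose v := (u - c) / p.
have uE : u = c + p * v by rewrite /v; field.
have cellE : cell mu (x 0%N) u <-> 0 <= v < 1.
  rewrite /cell -/c -/p uE lerDl ltrD2l pmulr_rge0//.
  by rewrite -[X in _ < X]mulr1 ltr_pM2l.
have hE : (c + p * lo <= u < c + p * lo + p * len) = (lo <= v < lo + len).
  by rewrite uE -addrA -mulrDr !lerD2l ltrD2l ler_pM2l// ltr_pM2l.
rewrite hE; split=> [h|h].
  have h0 : sel mu u = x 0%N := h 0%N isT.
  have v01 : 0 <= v < 1 by apply/cellE; apply/(selP mu _ u01).
  apply/(lo_walk v v01) => t tn.
  by have /= := h t.+1 tn; rewrite h0.
have v01 : 0 <= v < 1 by case/andP: h => *; lra.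
have h0 : sel mu u = x 0%N by apply/(selP mu _ u01); apply/cellE.
case=> [_|t tn] /=; first exact: h0.
by rewrite h0; move/(lo_walk v v01): h; exact.
Qed.

Let uniform_itv (lo len : R) : 0 <= lo -> 0 <= len -> lo + len <= 1 ->
  uniform_prob (@ltr01 R) `[lo, lo + len[ = len%:E.
Proof.
move=> lo0 len0 h; rewrite /uniform_prob.
rewrite (eq_integral (cst 1%E)); last first.
  move=> u; rewrite inE/= in_itv/= => /andP[u1 u2].
  by rewrite /uniform_pdf subr0 invr1 ifT//; apply/andP; split; lra.
rewrite integral_cst//= mul1e lebesgue_measure_itv/= lte_fin.
case: ifPn => [_|]; first by rewrite -EFinD addrAC subrr add0r.
by rewrite -leNgt => ?; congr EFin; lra.
Qed.

Let fold01 (u : R) : R := if 0 <= u < 1 then u else 0.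

Let markov_chain_walk K mu (x : nat -> T) (n : nat) :
  let E := [set w | forall t, (t <= n)%N -> walk K mu (fold01 w) t = x t] in
  measurable E /\
  uniform_prob (@ltr01 R) E =
    (mu (x 0%N) * \prod_(t < n) K (x t) (x t.+1))%:E.
Proof.
move=> E; have [lo /= [lo0 lo1 loP]] := walk_itv K n mu x.
set len := (X in lo + X) in lo1 loP *.
have len0 : 0 <= len.
  by rewrite mulr_ge0 ?fdist_ge0//; apply: prodr_ge0 => t _; exact: fdist_ge0.
pose B := ~` `[(0:R), 1[%classic.
have mB : measurable B by apply: measurableC.
have EI : E `&` `[0, 1[ = `[lo, lo + len[%classic.
  apply/seteqP; split=> [u [uE]|u]; rewrite /= !in_itv/=.
    by move=> u01; apply/(loP _ u01) => t /uE; rewrite /fold01 u01.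
  move=> h; have u01 : 0 <= u < 1 by case/andP: h => *; lra.
  by split=> // t tn; rewrite /fold01 u01; move/(loP _ u01): h; exact.
have EB : E `&` B = B \/ E `&` B = set0.
  have BE u : B u -> E u <-> E 0.
    rewrite /B /= in_itv/= => /negP/negbTE u01.
    by rewrite /E/= /fold01 u01 lexx ltr01.
  have [E0|E0] := pselect (E 0); [left|right].
    by apply/setIidr => u Bu; apply/(BE u Bu).
  by rewrite -subset0 => u [Eu Bu]; apply: E0; apply/(BE u Bu).
have mEB : measurable (E `&` B) by case: EB => ->.
have Edec : E = (E `&` `[0, 1[) `|` (E `&` B) by rewrite -setIUr setUCr setIT.
have mE : measurable E.
  by rewrite Edec EI; apply: measurableU.
split=> //; rewrite Edec measureU//; first last.
- by rewrite setIACA setICr setI0.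
- by rewrite EI.
rewrite EI [X in (X + _)%E](uniform_itv lo0 len0 lo1).
have PB0 : uniform_prob (@ltr01 R) B = 0%E.
  have := uniform_itv (lexx 0) ler01; rewrite add0r => /(_ (lexx 1)) P01.
  by rewrite probability_setC// [X in (_ - X)%E]P01 subee.
have PEB0 : uniform_prob (@ltr01 R) (E `&` B) = 0%E.
  by case: EB => ->//; exact: measure0.
by rewrite [X in (_ + X)%E]PEB0 adde0.
Qed.

Lemma markov_chain_exists_pointed K mu :
  exists X : R -> nat -> T, forall (x : nat -> T) (n : nat),
    let E := [set w | forall t, (t <= n)%N -> X w t = x t] in
    measurable E /\
    uniform_prob (@ltr01 R) E =
      (mu (x 0%N) * \prod_(t < n) K (x t) (x t.+1))%:E.
Proof. by eexists => x n; exact: markov_chain_walk. Qed.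

End markov_chain_existence.

Lemma markov_chain_exists (R : realType) (T : finType) (mu : fdist R T)
    (K : T -> fdist R T) :
  exists X : R -> nat -> T, forall (x : nat -> T) (n : nat),
    let E := [set w | forall t, (t <= n)%N -> X w t = x t] in
    measurable E /\
    uniform_prob (@ltr01 R) E =
      (mu (x 0%N) * \prod_(t < n) K (x t) (x t.+1))%:E.
Proof.
have [x0 _|T0] := pickP (@predT T); last first.
  by have := fdist_sum1 mu; rewrite big_pred0// => /esym/eqP; rewrite oner_eq0.
exact: markov_chain_exists_pointed x0 K mu.
Qed.

(* A Markov chain with initial law mu and kernel K, realized on the unit
   interval with the uniform probability.  Only its law, given by
   markov_chainP, is known; it determines every expectation below. *)
Definition markov_chain (R : realType) (T : finType) (mu : fdist R T)
    (K : T -> fdist R T) : R -> nat -> T :=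
  sval (cid (markov_chain_exists mu K)).

Lemma markov_chainP (R : realType) (T : finType) (mu : fdist R T)
    (K : T -> fdist R T) (x : nat -> T) (n : nat) :
  let E := [set w | forall t, (t <= n)%N -> markov_chain mu K w t = x t] in
  measurable E /\
  uniform_prob (@ltr01 R) E =
    (mu (x 0%N) * \prod_(t < n) K (x t) (x t.+1))%:E.
Proof. by rewrite /markov_chain; case: cid => X /= XP; exact: XP. Qed.

Section finite_distributions.
Context (R : realType).

Lemma dirac_ge0 (T : finType) (x y : T) : 0 <= (y == x)%:R :> R.
Proof. exact: ler0n. Qed.

Lemma dirac_sum1 (T : finType) (x : T) : \sum_y (y == x)%:R = 1 :> R.
Proof. by rewrite (bigD1 x)//= eqxx big1 ?addr0// => y /negbTE ->. Qed.

Definition fdist_dirac (T : finType) (x : T) : fdist R T :=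
  FDist (dirac_ge0 x) (dirac_sum1 x).

Context (S A : finType) (d : fdist R S) (k : S -> fdist R A).

Lemma semidirect_ge0 (x : S * A) : 0 <= d x.1 * k x.1 x.2.
Proof. by rewrite mulr_ge0// fdist_ge0. Qed.

Lemma semidirect_sum1 : \sum_(x : S * A) d x.1 * k x.1 x.2 = 1.
Proof.
rewrite -(pair_bigA _ (fun s a => d s * k s a))/= -(fdist_sum1 d).
by apply: eq_bigr => s _; rewrite -big_distrr/= fdist_sum1 mulr1.
Qed.

(* The law of (s, a) with s drawn from d and then a drawn from k s. *)
Definition fdist_semidirect : fdist R (S * A)%type :=
  FDist semidirect_ge0 semidirect_sum1.

End finite_distributions.

Record mdp (R : realType) (S A : finType) := MDP {
  transition : S -> A -> fdist R S;
  reward : S -> A -> R;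
  discount : R;
  reward_ge0 : forall s a, 0 <= reward s a;
  reward_le1 : forall s a, reward s a <= 1;
  discount_ge0 : 0 <= discount;
  discount_lt1 : discount < 1 }.

Definition policy (R : realType) (S A : finType) := S -> fdist R A.

Section values.
Context (R : realType) (S A : finType) (M : mdp R S A).
Implicit Types (pi : policy R S A) (s : S) (a : A).
Local Notation gamma := (discount M).

Definition discounted_return (x : nat -> S * A) : R :=
  limn (series (fun t => gamma ^+ t * reward M (x t).1 (x t).2)).

Definition trajectory pi (mu : fdist R (S * A)%type) : R -> nat -> S * A :=
  markov_chain mu (fun x => fdist_semidirect (transition M x.1 x.2) pi).

Definition expected_return pi (mu : fdist R (S * A)%type) : R :=
  fine 'E_(uniform_prob (@ltr01 R))
    [fun w => discounted_return (trajectory pi mu w)].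

Definition value pi s : R :=
  expected_return pi (fdist_semidirect (fdist_dirac R s) pi).

Definition qvalue pi s a : R := expected_return pi (fdist_dirac R (s, a)).

Definition advantage pi s a : R := qvalue pi s a - value pi s.

Definition opt_value s : R := sup [set value pi s | pi in [set: policy R S A]].

Definition opt_qvalue s a : R :=
  sup [set qvalue pi s a | pi in [set: policy R S A]].

Definition opt_advantage s a : R := opt_qvalue s a - opt_value s.

Definition sup_norm (f : S -> R) : R := \big[Num.max/0]_s `|f s|.

Definition value_error pi : R := sup_norm (fun s => opt_value s - value pi s).

Definition argmax (f : A -> R) : {set A} := [set a | [forall b, f b <= f a]]%SET.

Definition opt_actions s : {set A} := argmax (opt_advantage s).

Definition subopt_mass pi s : R := \sum_(a | a \notin opt_actions s) pi s a.

Definition nontrivial_states : {set S} :=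
  [set s | opt_actions s != [set: A]]%SET.

(* A real number as soon as nontrivial_states is nonempty. *)
Definition gap : R :=
  fine (\big[Order.min/+oo]_(s in nontrivial_states)
          \big[Order.min/+oo]_(a | a \notin opt_actions s)
            `|opt_advantage s a|%:E)%E.

Definition greedy_actions pi s : {set A} := argmax (advantage pi s).

Definition greedy_mass pi s : R := \sum_(a in greedy_actions pi s) pi s a.

(* When every action is greedy the second maximum is -oo and the gap is +oo. *)
Definition greedy_gap pi s : \bar R :=
  (\big[Order.max/-oo]_a (advantage pi s a)%:E -
   \big[Order.max/-oo]_(a | a \notin greedy_actions pi s)
     (advantage pi s a)%:E)%E.

Definition softmax_npg (eta : R) (pi : nat -> policy R S A) : Prop :=
  (forall s a, 0 < pi 0%N s a) /\
  (forall k s a, pi k.+1 s a =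
     pi k s a * expR (eta * advantage (pi k) s a) /
       \sum_b pi k s b * expR (eta * advantage (pi k) s b)).

Definition state_constant (eta eps : R) pi s : \bar R :=
  if eps < value_error pi
  then ((greedy_mass pi s)%:E * (expeR (eta%:E * greedy_gap pi s) - 1))%E
  else ((1 - subopt_mass pi s) * (expR (eta * (gap - eps)) - 1))%:E.

Definition npg_constant (eta eps : R) pi : \bar R :=
  \big[Order.min/+oo%E]_s state_constant eta eps pi s.

(* The extended inverse satisfies (1 + +oo)^-1 = 0. *)
Definition npg_rate (C : \bar R) : R :=
  1 - (1 - gamma) * (1 - fine ((1 + C)^-1)%E).

End values.

(* Main.v *)
(* Improving a deterministic policy of maximal total value greedily shows that
   it is optimal, so V* solves the Bellman optimality equation.  For an NPG step
   let G be a set of actions whose advantages exceed all others by at least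
   delta, and X the pi-average of the advantage over G.  Chebyshev's sum
   inequality off G and Jensen's inequality on G show that the new policy has
   expected advantage at least (1 - 1 / (1 + C)) X with
   C = pi(G) (exp (eta delta) - 1).  Far from the optimum take G greedy,
   where X = max_a A^t; near it take G optimal, where delta = Delta - eps works.
   In both cases X >= V* - V^t - gamma ||V* - V^t||, and monotonicity of policy
   improvement turns this into the one-step contraction. *)
Require Import Defs.
From mathcomp Require Import all_boot all_order all_algebra.
From mathcomp Require Import all_classical all_reals all_analysis.
From mathcomp Require Import measurable_realfun ring lra.
Import numFieldNormedType.Exports.
Import Order.TTheory GRing.Theory Num.Theory.
Local Open Scope classical_set_scope.
Local Open Scope ring_scope.

Set Implicit Arguments.
Unset Strict Implicit.
Unset Printing Implicit Defensive.

(** * Marginal laws of the Markov chain and expectations of functions of its state *)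

Lemma measure_bigcup_fintype (R : realType) d (Y : measurableType d)
    (P : {measure set Y -> \bar R}) (T : finType) (F : T -> set Y) :
  (forall z, measurable (F z)) -> trivIset setT F ->
  measurable (\bigcup_z F z) /\ P (\bigcup_z F z) = (\sum_z P (F z))%E.
Proof.
move=> mF tF; split.
  by apply: fin_bigcup_measurable => // *; exact: finite_finset.
have -> : [set: T] = [set` index_enum T].
  by apply/seteqP; split=> z //= _; exact: mem_index_enum.
rewrite measure_fin_bigcup//; last first.
  by apply: sub_trivIset tF.
by rewrite -fsbig_seq// index_enum_uniq.
Qed.

Section markov_chain_expectation.
Context (R : realType) (T : finType).
Variable K : T -> fdist R T.

(** The [n]-th power of the Markov operator of [K]: the expectation of [f] after [n] steps from the
    argument. *)
Definition kernel_iter (n : nat) (f : T -> R) : T -> R :=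
  iter n (fun g x => \sum_y K x y * g y) f.

Lemma kernel_iter_ge0 n f x :
  (forall y, 0 <= f y) -> 0 <= kernel_iter n f x.
Proof.
move=> f0; elim: n x => [|n IHn] x //=.
by apply: sumr_ge0 => y _; rewrite mulr_ge0 ?fdist_ge0.
Qed.

Lemma kernel_iter_le n f c x :
  (forall y, f y <= c) -> kernel_iter n f x <= c.
Proof.
move=> fc; elim: n x => [|n IHn] x //=.
rewrite -[leRHS]mul1r -(fdist_sum1 (K x)) mulr_suml.
by apply: ler_sum => y _; rewrite ler_wpM2l ?fdist_ge0.
Qed.

Lemma kernel_iter_sum n (I : finType) (c : I -> R) (F : I -> T -> R) x :
  kernel_iter n (fun z => \sum_i c i * F i z) x =
  \sum_i c i * kernel_iter n (F i) x.
Proof.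
elim: n x => [|n IHn] x //=.
under eq_bigr do rewrite IHn mulr_sumr.
rewrite exchange_big/=; apply: eq_bigr => i _.
by rewrite mulr_sumr; apply: eq_bigr => y _; rewrite mulrCA.
Qed.

Variable mu : fdist R T.
Local Notation X := (markov_chain mu K).
Local Notation P := (uniform_prob (@ltr01 R)).

(** Only laws of initial segments are given by [markov_chainP]. Keeping a prefix in the event makes
    the induction on [m] work: splitting by the state at time [j + 1] lengthens the prefix by one
    and shortens the remaining walk by one. *)
Lemma markov_chain_prefix_law (m j : nat) (x : nat -> T) (y : T) :
  let E := [set w | (forall t, (t <= j)%N -> X w t = x t) /\
                    X w (j + m)%N = y] in
  measurable E /\
  P E = (mu (x 0%N) * \prod_(t < j) K (x t) (x t.+1) *
         kernel_iter m (fun z => (z == y)%:R) (x j))%:E.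
Proof.
elim: m j x => [|m IHm] j x E.
  have [mE PE] := markov_chainP mu K x j.
  have [xy|xy] := eqVneq (x j) y.
    have -> : E = [set w | forall t, (t <= j)%N -> X w t = x t].
      apply/seteqP; split=> [w []//|w Ew]; split=> //.
      by rewrite addn0 Ew.
    by split=> //; rewrite PE /= xy eqxx mulr1.
  have -> : E = set0.
    rewrite -subset0 => w [Ew]; rewrite addn0 Ew// => /eqP.
    by rewrite (negbTE xy).
  by split; [exact: measurable0|rewrite measure0 /= (negbTE xy) mulr0].
(* The prefix extended by [z] at time [j + 1]; later values of [x'] are never read. *)
pose x' z t := if (t <= j)%N then x t else z.
pose F z := [set w | (forall t, (t <= j.+1)%N -> X w t = x' z t) /\
                    X w (j.+1 + m)%N = y].
have EF : E = \bigcup_(z in [set: T]) F z.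
  apply/seteqP; split=> [w [Ew wy]|w [z _ [Ew wy]]].
    exists (X w j.+1) => //; split; last by rewrite addSnnS.
    move=> t; rewrite leq_eqVlt => /orP[/eqP->|]; first by rewrite /x' ltnn.
    by rewrite ltnS /x' => tj; rewrite tj Ew.
  split; last by rewrite -addSnnS.
  by move=> t tj; rewrite Ew ?(leq_trans tj)// /x' tj.
have mF z : measurable (F z) by case: (IHm j.+1 (x' z)).
have tF : trivIset setT F.
  move=> z1 z2 _ _ [w [[h1 _] [h2 _]]].
  by have := h1 j.+1 (leqnn _); rewrite h2// /x' ltnn.
have [mU PU] := measure_bigcup_fintype P mF tF.
rewrite EF; split=> //; rewrite PU.
rewrite (eq_bigr _ (fun z _ => (IHm j.+1 (x' z)).2)).
rewrite sumEFin; congr EFin; rewrite [X in _ * X]/= mulr_sumr.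
apply: eq_bigr => z _; rewrite big_ord_recr/= /x' leq0n leqnn ltnn !mulrA.
congr (_ * _ * _ * _); apply: eq_bigr => t _.
by rewrite (ltnW (ltn_ord t)) ltn_ord.
Qed.

Lemma markov_chain_law (n : nat) (y : T) :
  let E := [set w | X w n = y] in
  measurable E /\
  P E = (\sum_x mu x * kernel_iter n (fun z => (z == y)%:R) x)%:E.
Proof.
move=> E.
pose F z := [set w | (forall t, (t <= 0)%N -> X w t = z) /\
                    X w (0 + n)%N = y].
have EF : E = \bigcup_(z in [set: T]) F z.
  apply/seteqP; split=> [w Ew|w [z _ []//]].
  by exists (X w 0%N) => //; split=> // t; rewrite leqn0 => /eqP->.
have mF z : measurable (F z) by case: (markov_chain_prefix_law n 0 (cst z) y).
have tF : trivIset setT F.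
  move=> z1 z2 _ _ [w [[h1 _] [h2 _]]].
  by have := h1 0%N (leqnn _); rewrite h2.
have [mU PU] := measure_bigcup_fintype P mF tF.
rewrite EF; split=> //; rewrite PU -sumEFin; apply: eq_bigr => z _.
have [_ /= PF] := markov_chain_prefix_law n 0 (cst z) y.
by rewrite big_ord0 mulr1 in PF.
Qed.

(** A finite combination of indicators, from which both measurability and the integral follow. *)
Lemma markov_chain_fun_indic (f : T -> R) n w :
  f (X w n) = \sum_y f y * \1_[set w' | X w' n = y] w.
Proof.
rewrite (bigD1 (X w n))//= indicE mem_set// mulr1 big1 ?addr0// => y yX.
by rewrite indicE memNset ?mulr0//= => /esym/eqP; rewrite (negbTE yX).
Qed.

Lemma measurable_markov_chain_fun (f : T -> R) n :
  measurable_fun setT (fun w => f (X w n)).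
Proof.
under eq_fun do rewrite (markov_chain_fun_indic f n).
apply: measurable_sum => y; apply: measurable_funM => //.
by apply: measurable_indic; case: (markov_chain_law n y).
Qed.

Lemma integral_markov_chain_fun (f : T -> R) n : (forall x, 0 <= f x) ->
  (\int[P]_w (f (X w n))%:E = (\sum_x mu x * kernel_iter n f x)%:E)%E.
Proof.
move=> f0.
under eq_integral => w _ do rewrite (markov_chain_fun_indic f n) -sumEFin.
rewrite ge0_integral_sum//; first last.
- by move=> y w _; rewrite lee_fin mulr_ge0.
- move=> y; apply/measurable_EFinP; apply: measurable_funM => //.
  by apply: measurable_indic; case: (markov_chain_law n y).
rewrite (eq_bigr (fun y => (f y * \sum_x mu x *
    kernel_iter n (fun z => (z == y)%:R) x)%:E)); last first.
  move=> y _; have [mE PE] := markov_chain_law n y.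
  under eq_integral do rewrite EFinM.
  rewrite ge0_integralZl_EFin//; last first.
    by apply/measurable_EFinP; exact: measurable_indic.
  by rewrite integral_indic// setIT EFinM; congr (_ * _)%E.
rewrite sumEFin; congr EFin.
under eq_bigr do rewrite mulr_sumr.
rewrite exchange_big/=; apply: eq_bigr => x _.
under eq_bigr do rewrite mulrCA.
(* Linearity of [kernel_iter] recombines the point indicators into [f]. *)
rewrite -mulr_sumr -kernel_iter_sum; congr (_ * _).
congr (kernel_iter n _ x); apply/funext => z.
rewrite (bigD1 z)//= eqxx mulr1 big1 ?addr0// => y yz.
by rewrite eq_sym (negbTE yz) mulr0.
Qed.

End markov_chain_expectation.

(** * Discounted series of sequences in $[0,1]$ *)

Section discounted_series.
Context (R : realType) (g : R).
Hypothesis g01 : 0 <= g < 1.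
Local Notation dseries u := (series (fun t => g ^+ t * u t)).

Lemma is_cvg_discounted_series (u : nat -> R) :
  (forall n, 0 <= u n <= 1) -> cvgn (dseries u).
Proof.
move=> u01; have /andP[g0 g1] := g01.
apply: (@series_le_cvg _ _ (geometric 1 g)).
- by move=> n; have /andP[] := u01 n => *; rewrite mulr_ge0 ?exprn_ge0.
- by move=> n; rewrite /geometric/= mul1r exprn_ge0.
- move=> n; rewrite /geometric/= mul1r ler_piMr ?exprn_ge0//.
  by case/andP: (u01 n).
- by apply: is_cvg_geometric_series; rewrite ger0_norm.
Qed.

Lemma lim_discounted_series_sum (I : finType) (c : I -> R) (F : I -> nat -> R) :
  (forall i n, 0 <= F i n <= 1) ->
  limn (dseries (fun t => \sum_i c i * F i t)) =
  \sum_i c i * limn (dseries (F i)).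
Proof.
move=> F01; apply: cvg_lim => //.
have -> : dseries (fun t => \sum_i c i * F i t) =
    (fun n => \sum_i c i * dseries (F i) n).
  apply/funext => n; rewrite /series/=.
  under eq_bigr do rewrite mulr_sumr.
  rewrite exchange_big/=; apply: eq_bigr => i _.
  by rewrite mulr_sumr; apply: eq_bigr => t _; rewrite mulrCA.
apply: cvg_big => [|i _]; [exact: add_continuous|apply: cvgMl_tmp].
exact: is_cvg_discounted_series.
Qed.

Lemma lim_discounted_seriesS (u : nat -> R) : (forall n, 0 <= u n <= 1) ->
  limn (dseries u) = u 0%N + g * limn (dseries (fun t => u t.+1)).
Proof.
move=> u01; apply: cvg_lim => //; rewrite -cvg_shiftS.
have -> : [sequence dseries u n.+1]_n =
    (fun n => u 0%N + g * dseries (fun t => u t.+1) n).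
  apply/funext => n; rewrite /series/= big_nat_recl//= expr0 mul1r.
  congr (_ + _); rewrite mulr_sumr; apply: eq_bigr => t _.
  by rewrite exprS mulrA.
apply: cvgD; first exact: cvg_cst.
apply: cvgMl_tmp; apply: is_cvg_discounted_series => n; exact: u01.
Qed.

End discounted_series.

(** * Bellman equations of a fixed policy *)

Section bellman_equations.
Context (R : realType) (S A : finType) (M : mdp R S A).
Implicit Types (pi : policy R S A) (s : S) (a : A).
Local Notation gamma := (discount M).

Let gamma01 : 0 <= gamma < 1.
Proof. by rewrite discount_ge0 discount_lt1. Qed.

Let K pi (x : S * A) := fdist_semidirect (transition M x.1 x.2) pi.
Let r (x : S * A) := reward M x.1 x.2.

Let r_ge0 x : 0 <= r x. Proof. exact: reward_ge0. Qed.

Let kernel_iter_r01 pi x n : 0 <= kernel_iter (K pi) n r x <= 1.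
Proof.
by rewrite kernel_iter_ge0// kernel_iter_le// => y; exact: reward_le1.
Qed.

(** The value from a state-action pair as a series free of the random trajectory; [qvalueW]
    identifies it with [qvalue]. *)
Let W pi x := limn (series (fun t => gamma ^+ t * kernel_iter (K pi) t r x)).

(** All terms are nonnegative, so expectation and infinite sum commute; the terms of the resulting
    series are at most $\gamma^t$. *)
Let expected_returnE pi mu :
  expected_return M pi mu = \sum_x mu x * W pi x.
Proof.
rewrite /expected_return unlock.
pose u w t := gamma ^+ t * r (trajectory M pi mu w t).
have u0 w t : 0 <= u w t by rewrite mulr_ge0 ?exprn_ge0 ?discount_ge0.
under eq_integral => w _.
  rewrite /= /discounted_return -/(u w) -EFin_lim; last first.
    apply: is_cvg_discounted_series => // n.
    by rewrite r_ge0 reward_le1.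
  over.
rewrite (_ : (fun w => _) =
    (fun w => \sum_(0 <= t <oo) (u w t)%:E)%E); last first.
  apply/funext => w; congr (limn _); apply/funext => n /=.
  by rewrite /series/= sumEFin.
rewrite integral_nneseries//; first last.
- by move=> t w _; rewrite lee_fin.
- move=> t; apply/measurable_EFinP; apply: measurable_funM => //.
  exact: measurable_markov_chain_fun.
rewrite (_ : (fun n => _) = EFin \o
    (series (fun t => gamma ^+ t * \sum_x mu x * kernel_iter (K pi) t r x))).
  rewrite EFin_lim/=; last first.
    apply: is_cvg_discounted_series => // n.
    rewrite sumr_ge0 => [|x _]; last first.
      by have /andP[? _] := kernel_iter_r01 pi x n; rewrite mulr_ge0 ?fdist_ge0.
    rewrite -(fdist_sum1 mu); apply: ler_sum => x _.
    have /andP[_ ?] := kernel_iter_r01 pi x n.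
    by rewrite ler_piMr ?fdist_ge0.
  by rewrite lim_discounted_series_sum.
apply/funext => n; rewrite /= /series/= -sumEFin; apply: eq_bigr => t _.
under eq_integral do rewrite EFinM.
rewrite ge0_integralZl_EFin//; first last.
- by rewrite exprn_ge0 ?discount_ge0.
- by apply/measurable_EFinP; exact: measurable_markov_chain_fun.
- by move=> w _; rewrite lee_fin.
by rewrite (integral_markov_chain_fun _ _ t r_ge0).
Qed.

(** Splitting off time 0 leaves a series whose terms are, by the recursion of [kernel_iter],
    one-step averages over [y]. *)
Let W_bellman pi x : W pi x = r x + gamma * \sum_y K pi x y * W pi y.
Proof.
rewrite /W lim_discounted_seriesS//; congr (_ + _ * _).
by rewrite -lim_discounted_series_sum.
Qed.

Let sum_semidirect d pi (f : S * A -> R) :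
  \sum_x fdist_semidirect d pi x * f x =
  \sum_s d s * \sum_a pi s a * f (s, a).
Proof.
under [RHS]eq_bigr do rewrite mulr_sumr.
by rewrite pair_bigA; apply: eq_bigr => -[s a] _ /=; rewrite mulrA.
Qed.

Let sum_dirac (T : finType) (x : T) (f : T -> R) :
  \sum_y fdist_dirac R x y * f y = f x.
Proof.
rewrite (bigD1 x)//= eqxx mul1r big1 ?addr0// => y /negbTE ->.
by rewrite mul0r.
Qed.

Let qvalueW pi s a : qvalue M pi s a = W pi (s, a).
Proof. by rewrite /qvalue expected_returnE sum_dirac. Qed.

Lemma value_qvalue pi s : value M pi s = \sum_a pi s a * qvalue M pi s a.
Proof.
rewrite /value expected_returnE sum_semidirect sum_dirac.
by apply: eq_bigr => a _; rewrite qvalueW.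
Qed.

Lemma qvalue_value pi s a : qvalue M pi s a =
  reward M s a + gamma * \sum_s' transition M s a s' * value M pi s'.
Proof.
rewrite qvalueW W_bellman; congr (_ + _ * _).
rewrite sum_semidirect; apply: eq_bigr => s' _; congr (_ * _).
by rewrite value_qvalue; apply: eq_bigr => b _; rewrite qvalueW.
Qed.

End bellman_equations.

(** * Existence of an optimal policy and the Bellman optimality equation *)

Lemma fdist_avg_le (R : realType) (T : finType) (d : fdist R T)
    (f : T -> R) (c : R) :
  (forall x, f x <= c) -> \sum_x d x * f x <= c.
Proof.
move=> fc; rewrite -[leRHS]mul1r -(fdist_sum1 d) mulr_suml.
by apply: ler_sum => x _; rewrite ler_wpM2l ?fdist_ge0.
Qed.

Lemma fdist_avg_ge (R : realType) (T : finType) (d : fdist R T)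
    (f : T -> R) (c : R) :
  (forall x, c <= f x) -> c <= \sum_x d x * f x.
Proof.
move=> fc; rewrite -[leLHS]mul1r -(fdist_sum1 d) mulr_suml.
by apply: ler_sum => x _; rewrite ler_wpM2l ?fdist_ge0.
Qed.

Section optimality.
Context (R : realType) (S A : finType) (M : mdp R S A).
Implicit Types (pi : policy R S A) (s : S) (a : A) (V : S -> R).
Local Notation gamma := (discount M).

(** The one-step Bellman lookahead from [V]. *)
Definition backup V s a : R :=
  reward M s a + gamma * \sum_s' transition M s a s' * V s'.

Lemma qvalue_backup pi : qvalue M pi = backup (value M pi).
Proof. by apply/funext => s; apply/funext => a; rewrite qvalue_value. Qed.

Lemma value_backup pi s :
  value M pi s = \sum_a pi s a * backup (value M pi) s a.
Proof. by rewrite value_qvalue qvalue_backup. Qed.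

Lemma le_backup V V' s a :
  (forall s', V s' <= V' s') -> backup V s a <= backup V' s a.
Proof.
move=> VV'; rewrite lerD2l ler_wpM2l ?discount_ge0//.
by apply: ler_sum => s' _; rewrite ler_wpM2l ?fdist_ge0.
Qed.

Lemma backupB V V' s a : backup V s a - backup V' s a =
  gamma * \sum_s' transition M s a s' * (V s' - V' s').
Proof.
rewrite opprD addrACA subrr add0r -mulrBr -sumrB.
by under eq_bigr do rewrite -mulrBr.
Qed.

(** A maximum principle: at a maximizer [m] the hypothesis gives $f(m)\le\gamma f(m)$, and
    $\gamma<1$ forces $f(m)\le0$. *)
Lemma discounted_avg_comparison pi (f : S -> R) :
  (forall s, f s <=
     gamma * \sum_a pi s a * \sum_s' transition M s a s' * f s') ->
  forall s, f s <= 0.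
Proof.
move=> fle s0.
case: (@Order.TotalTheory.arg_maxP _ _ _ s0 xpredT f isT) => m _ mP.
rewrite (le_trans (mP s0 isT))//.
have : f m <= gamma * f m.
  apply: le_trans (fle m) _; rewrite ler_wpM2l ?discount_ge0//.
  by apply: fdist_avg_le => a; apply: fdist_avg_le => s'; exact: mP.
rewrite -subr_ge0 -{2}[f m]mul1r -mulrBl nmulr_rge0//.
by rewrite subr_lt0 discount_lt1.
Qed.

Let backup_avgB V V' pi s :
  \sum_a pi s a * backup V s a - \sum_a pi s a * backup V' s a =
  gamma * \sum_a pi s a * \sum_s' transition M s a s' * (V s' - V' s').
Proof.
rewrite -sumrB mulr_sumr; apply: eq_bigr => a _.
by rewrite -mulrBr backupB mulrCA.
Qed.

(** As [value M pi] solves its Bellman equation, its difference from the subsolution [V] obeys the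
    maximum principle. [value_le] is the dual for supersolutions. *)
Lemma le_value pi V :
  (forall s, V s <= \sum_a pi s a * backup V s a) ->
  forall s, V s <= value M pi s.
Proof.
move=> VT s; rewrite -subr_le0; move: s.
apply: (discounted_avg_comparison (pi := pi)) => s.
by rewrite -backup_avgB -value_backup lerB.
Qed.

Lemma value_le pi V :
  (forall s, \sum_a pi s a * backup V s a <= V s) ->
  forall s, value M pi s <= V s.
Proof.
move=> TV s; rewrite -subr_le0; move: s.
apply: (discounted_avg_comparison (pi := pi)) => s.
by rewrite -backup_avgB -value_backup lerB.
Qed.

Let det (d : {ffun S -> A}) : policy R S A := fun s => fdist_dirac R (d s).

Let value_det d s : value M (det d) s = backup (value M (det d)) s (d s).
Proof.
rewrite [LHS]value_backup /det (bigD1 (d s))//= eqxx mul1r big1 ?addr0// => a.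
by move/negbTE ->; rewrite mul0r.
Qed.

Variable a0 : A.

(** Deterministic policies are finite in number, so one maximizes the sum of its values over all
    states. Its greedy improvement is nowhere worse, hence has the same value function, so no action
    improves on it. *)
Let exists_greedy_det : exists d : {ffun S -> A}, forall s a,
  backup (value M (det d)) s a <= value M (det d) s.
Proof.
case: (@Order.TotalTheory.arg_maxP _ _ _ ([ffun=> a0] : {ffun S -> A}) xpredT
  (fun d : {ffun S -> A} => \sum_s value M (det d) s) isT) => d _ dP.
exists d => s a; set V := value M (det d).
have /fin_all_exists[g gP] s' :
    exists b, forall a', backup V s' a' <= backup V s' b.
  case: (@Order.TotalTheory.arg_maxP _ _ _ a0 xpredT (backup V s') isT).
  by move=> b _ bP; exists b => a'; exact: bP.
pose d' : {ffun S -> A} := [ffun s' => g s'].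
have Vle : forall s', V s' <= value M (det d') s'.
  apply: le_value => s'; rewrite (bigD1 (g s'))//= ffunE eqxx mul1r.
  rewrite big1 ?addr0 => [|b /negbTE ->]; last by rewrite mul0r.
  by rewrite /V [leLHS]value_det gP.
(* The differences are nonnegative and, by maximality of [d], their sum is at most 0. *)
have VE : V = value M (det d').
  apply/funext => s'; apply/eqP; rewrite eq_sym -subr_eq0; move: s'.
  have ge0 s' : true -> 0 <= value M (det d') s' - V s' by rewrite subr_ge0.
  move=> s'; apply/eqP; apply: (psumr_eq0P ge0) => //.
  apply/le_anti; rewrite sumr_ge0 ?andbT// sumrB subr_le0.
  exact: dP d' isT.
by rewrite (le_trans (gP s a))// {2}VE value_det -VE ffunE.
Qed.

(** The deterministic policy just found dominates every policy, so the suprema defining $V^*$ and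
    $Q^*$ are both attained by it. *)
Lemma exists_optimal_policy : exists d : S -> A,
  [/\ forall s a, backup (opt_value M) s a <= opt_value M s,
      forall s, backup (opt_value M) s (d s) = opt_value M s,
      forall pi s, value M pi s <= opt_value M s
    & opt_qvalue M = backup (opt_value M)].
Proof.
have [d dP] := exists_greedy_det.
have Vle pi : forall s, value M pi s <= value M (det d) s.
  by apply: value_le => s; apply: fdist_avg_le => a; exact: dP.
have VE : opt_value M = value M (det d).
  apply/funext => s; apply/le_anti/andP; split.
    apply: ge_sup; first by exists (value M (det d) s), (det d).
    by move=> _ [pi _ <-].
  apply: ub_le_sup; last by exists (det d).
  by exists (value M (det d) s) => _ [pi _ <-].
have QE : opt_qvalue M = qvalue M (det d).
  have Qle pi s a : qvalue M pi s a <= qvalue M (det d) s a.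
    by rewrite !qvalue_backup le_backup.
  apply/funext => s; apply/funext => a; apply/le_anti/andP; split.
    apply: ge_sup; first by exists (qvalue M (det d) s a), (det d).
    by move=> _ [pi _ <-].
  apply: ub_le_sup; last by exists (det d).
  by exists (qvalue M (det d) s a) => _ [pi _ <-].
by exists d; rewrite QE VE qvalue_backup; split.
Qed.

End optimality.

(** * The softmax update at a single state *)

(** Symmetrization: twice the difference [D] of the two sides is
    $\sum_{i,j}p_ip_j(w_i-w_j)(y_i-y_j)$. *)
Lemma chebyshev_sum_le (R : realFieldType) (I : finType) (P : pred I)
    (p w y : I -> R) :
  (forall i, 0 <= p i) -> (forall i j, (w i - w j) * (y i - y j) <= 0) ->
  (\sum_(i | P i) p i) * (\sum_(i | P i) p i * w i * y i) <=
  (\sum_(i | P i) p i * w i) * (\sum_(i | P i) p i * y i).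
Proof.
move=> p0 wy; rewrite -subr_le0.
set D := (X in X <= 0).
have DE : D = \sum_(i | P i) \sum_(j | P j) p i * p j * (w i * (y i - y j)).
  rewrite /D mulrC !mulr_suml -sumrB; apply: eq_bigr => i _.
  rewrite !mulr_sumr -sumrB; apply: eq_bigr => j _; ring.
have DE' : D = \sum_(i | P i) \sum_(j | P j) p i * p j * (w j * (y j - y i)).
  rewrite DE exchange_big/=; apply: eq_bigr => i _; apply: eq_bigr => j _.
  by rewrite [p j * _]mulrC.
suff : D + D <= 0 by lra.
rewrite {1}DE DE' -big_split/=; apply: sumr_le0 => i _.
rewrite -big_split/=; apply: sumr_le0 => j _.
rewrite -mulrDr mulr_ge0_le0 ?mulr_ge0//.
by rewrite (le_trans _ (wy i j))// le_eqVlt; apply/orP; left; apply/eqP; ring.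
Qed.

Section softmax_step.
Context (R : realType) (A : finType) (p : fdist R A) (f : A -> R).
Context (eta delta X : R) (G : {set A}).
Hypothesis eta_gt0 : 0 < eta.
Hypothesis avg0 : \sum_a p a * f a = 0.

(** By $e^x\ge1+x$, since the linear term averages to zero. *)
Lemma softmax_normalizer_ge1 : 1 <= \sum_a p a * expR (eta * f a).
Proof.
rewrite (@le_trans _ _ (\sum_a (p a + eta * (p a * f a))))//.
  by rewrite big_split/= -mulr_sumr avg0 mulr0 addr0 fdist_sum1.
apply: ler_sum => a _; rewrite mulrCA -{1}[p a]mulr1 -mulrDr.
by rewrite ler_wpM2l ?fdist_ge0// expR_ge1Dx.
Qed.

Hypothesis delta_ge0 : 0 <= delta.
Hypothesis avgG : \sum_(a in G) p a * (X - f a) = 0.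
Hypothesis gapG : forall b, b \notin G -> delta <= X - f b.

(** With $y=X-f$ and $w=e^{-\eta y}$ the right-hand side is $X-Y/Z$, where $Y=\sum pwy$ and $Z=\sum
    pw$; the claim becomes $Y(1+C)\le XZ$. Hypothesis [avgG] makes [X] the average of [f] over [G]
    without a division, so [G] may have mass zero. *)
Lemma softmax_step_advantage :
  (1 - (1 + (\sum_(a in G) p a) * (expR (eta * delta) - 1))^-1) * X <=
  \sum_a (p a * expR (eta * f a) / \sum_b p b * expR (eta * f b)) * f a.
Proof.
pose y a := X - f a; pose w a := expR (- (eta * y a)).
set q := \sum_(a in G) p a; set C := q * _.
have p0 a : 0 <= p a by exact: fdist_ge0.
have w0 a : 0 < w a by exact: expR_gt0.
have wy i j : (w i - w j) * (y i - y j) <= 0.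
  have [yij|yji] := leP (y i) (y j).
    rewrite mulr_ge0_le0 ?subr_ge0 ?subr_le0// /w ler_expR lerN2.
    by rewrite ler_wpM2l// ltW.
  rewrite mulr_le0_ge0 ?subr_ge0 ?subr_le0 ?(ltW yji)// /w ler_expR lerN2.
  by rewrite ler_wpM2l// ltW.
(* As [f] averages to zero, [X] is the average of [y], and its part over [G] vanishes by [avgG]. *)
have XE : X = \sum_(a | a \notin G) p a * y a.
  have -> : X = \sum_a p a * y a.
    under eq_bigr do rewrite mulrBr.
    by rewrite sumrB avg0 subr0 -mulr_suml fdist_sum1 mul1r.
  by rewrite (bigID (mem G))/= [X in X + _]avgG add0r.
have X0 : 0 <= X.
  rewrite XE; apply: sumr_ge0 => a aG.
  by rewrite mulr_ge0 ?(le_trans delta_ge0 (gapG aG)).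
pose q' := \sum_(a | a \notin G) p a.
have qq' : q + q' = 1 by rewrite -(fdist_sum1 p) [RHS](bigID (mem G)).
have q0 : 0 <= q by apply: sumr_ge0.
have e1 : 1 <= expR (eta * delta).
  by rewrite -expR0 ler_expR mulr_ge0// ltW.
have C0 : 0 <= C by rewrite mulr_ge0// subr_ge0.
pose Z := \sum_a p a * w a.
pose ZG := \sum_(a in G) p a * w a.
pose ZN := \sum_(a | a \notin G) p a * w a.
have ZE : Z = ZG + ZN by rewrite /Z (bigID (mem G)).
pose Y := \sum_a p a * w a * y a.
pose YG := \sum_(a in G) p a * w a * y a.
pose YN := \sum_(a | a \notin G) p a * w a * y a.
have YE : Y = YG + YN by rewrite /Y (bigID (mem G)).
(* Again $e^x\ge1+x$, now with [y] summing to zero over [G]. *)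
have ZGq : q <= ZG.
  have -> : q = \sum_(a in G) (p a - eta * (p a * y a)).
    by rewrite sumrB -mulr_sumr avgG mulr0 subr0.
  apply: ler_sum => a _; rewrite mulrCA -{1}[p a]mulr1 -mulrBr.
  by rewrite ler_wpM2l// expR_ge1Dx.
(* Since [w] decreases in [y], Chebyshev on [G] gives $q\,Y_G\le0$; if $q=0$, every mass in [G] is
   zero. *)
have YG0 : YG <= 0.
  have := chebyshev_sum_le (mem G) p0 wy.
  rewrite [X in _ <= _ * X]avgG mulr0 -/YG -/q.
  have [q_gt0|q_le0] := ltP 0 q; first by rewrite pmulr_rle0.
  have pG0 a : a \in G -> p a = 0.
    apply: (@psumr_eq0P _ _ (mem G) p) => //.
    by apply/le_anti; rewrite q_le0.
  by move=> _; rewrite /YG big1// => a aG; rewrite pG0// !mul0r.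
have YN1 : q' * YN <= ZN * X.
  have := chebyshev_sum_le (fun a => a \notin G) p0 wy.
  by rewrite -XE.
(* Off [G], $y\ge\delta$ gives $w\le e^{-\eta\delta}$. *)
have YN2 : YN * expR (eta * delta) <= X.
  rewrite XE mulr_suml; apply: ler_sum => a aG.
  rewrite [p a * w a * y a]mulrAC -[_ * w a * _]mulrA ler_piMr//.
    by rewrite mulr_ge0 ?(le_trans delta_ge0 (gapG aG)).
  rewrite -expRD -expR0 ler_expR addrC subr_le0 ler_wpM2l ?(ltW eta_gt0)//.
  exact: gapG.
have Z0 : 0 < \sum_a p a * expR (eta * f a).
  exact: lt_le_trans softmax_normalizer_ge1.
have ewE a : expR (eta * f a) = expR (eta * X) * w a.
  by rewrite -expRD; congr expR; rewrite /y; ring.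
have ZZ : \sum_a p a * expR (eta * f a) = expR (eta * X) * Z.
  by rewrite mulr_sumr; apply: eq_bigr => a _; rewrite ewE mulrCA.
have Z_gt0 : 0 < Z by move: Z0; rewrite ZZ pmulr_rgt0// expR_gt0.
(* As $1+C=q'+qe^{\eta\delta}$, the bound splits: [YN1] gives $q'Y_N\le Z_NX$, while [YN2] and [ZGq]
   give $qe^{\eta\delta}Y_N\le qX\le Z_GX$. *)
have main : Y * (1 + C) <= X * Z.
  have -> : 1 + C = q' + q * expR (eta * delta) by rewrite -qq' /C; ring.
  rewrite (@le_trans _ _ (YN * (q' + q * expR (eta * delta))))//.
    rewrite ler_wpM2r ?addr_ge0 ?mulr_ge0 ?expR_ge0//; last by rewrite YE gerDr.
    by apply: sumr_ge0.
  rewrite mulrDr ZE mulrDr addrC lerD//; last by rewrite mulrC [leRHS]mulrC.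
  by rewrite mulrCA (le_trans (ler_wpM2l q0 YN2))// mulrC ler_wpM2l.
have -> : \sum_a (p a * expR (eta * f a) / \sum_b p b * expR (eta * f b)) * f a
    = X - Y / Z.
  have -> : Y = X * Z - \sum_a p a * w a * f a.
    rewrite mulr_sumr -sumrB; apply: eq_bigr => a _; rewrite /y; ring.
  rewrite mulrBl mulfK ?gt_eqF// subKr mulr_suml; apply: eq_bigr => a _.
  rewrite ZZ ewE; field.
  by rewrite !gt_eqF ?expR_gt0.
rewrite mulrBl mul1r lerD2l lerN2 ler_pdivrMr// -mulrA mulrC ler_pdivlMr//.
by rewrite ltr_pwDl.
Qed.

End softmax_step.

(** * Bounds and monotonicity of the contraction factor in the extended constant *)

Section npg_rate_theory.
Context (R : realType) (S A : finType) (M : mdp R S A).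
Local Notation gamma := (discount M).
Implicit Types C : \bar R.

Lemma fine_inv1D_bounds C : (0 <= C)%E -> 0 <= fine ((1 + C)^-1)%E <= 1.
Proof.
case: C => [c|_|//]; last by rewrite addey// /inve/= lexx ler01.
rewrite lee_fin => c0; have c1 : 1 + c != 0 by rewrite gt_eqF// ltr_pwDl.
rewrite -EFinD /inve (negbTE c1)/= invr_ge0 addr_ge0//=.
by rewrite invf_le1 ?lerDl// ltr_pwDl.
Qed.

Lemma fine_inv1D_anti C C' : (0 <= C)%E -> (C <= C')%E ->
  fine ((1 + C')^-1)%E <= fine ((1 + C)^-1)%E.
Proof.
move=> C0; case: C' => [c'||] CC'; last by move: (le_trans C0 CC').
  move: C C0 CC' => [c||] //; rewrite !lee_fin => c0 cc'.
  have c1 : 0 < 1 + c by rewrite ltr_pwDl.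
  have c1' : 0 < 1 + c' by rewrite ltr_pwDl// (le_trans c0).
  by rewrite -!EFinD /inve !gt_eqF//= lef_pV2 ?posrE// lerD2l.
(* For infinite [C'] the left-hand side is 0. *)
by rewrite addey// [X in X <= _]/=; have /andP[] := fine_inv1D_bounds C0.
Qed.

Lemma npg_rate_ge0 C : (0 <= C)%E -> 0 <= npg_rate M C.
Proof.
move=> /fine_inv1D_bounds; rewrite /npg_rate.
have := discount_ge0 M; have := discount_lt1 M.
set i := fine _ => g1 g0 /andP[i0 i1].
have : (1 - gamma) * (1 - i) <= 1 - gamma.
  by rewrite ler_piMr ?gerBl// subr_ge0 ltW.
lra.
Qed.

Lemma npg_rate_anti C C' : (0 <= C)%E -> (C <= C')%E ->
  npg_rate M C' <= npg_rate M C.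
Proof.
move=> C0 /(fine_inv1D_anti C0) CC'.
rewrite lerD2l lerN2 ler_wpM2l ?subr_ge0 ?(ltW (discount_lt1 M))//.
by rewrite lerD2l lerN2.
Qed.

End npg_rate_theory.

(** * Contraction of the value error in one NPG step *)

Section npg_step.
Context (R : realType) (S A : finType) (M : mdp R S A).
Local Notation gamma := (discount M).
Local Notation Vo := (opt_value M).
Implicit Types (pi : policy R S A) (s : S) (a : A).

Lemma advantage_backup pi s a :
  advantage M pi s a = backup M (value M pi) s a - value M pi s.
Proof. by rewrite /advantage qvalue_backup. Qed.

Lemma avg_advantage0 pi s : \sum_a pi s a * advantage M pi s a = 0.
Proof.
under eq_bigr do rewrite advantage_backup mulrBr.
by rewrite sumrB -value_backup -mulr_suml fdist_sum1 mul1r subrr.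
Qed.

Lemma value_error_ge pi s : Vo s - value M pi s <= value_error M pi.
Proof.
apply: le_trans (ler_norm _) _.
exact: (le_bigmax _ (fun s => `|Vo s - value M pi s|)).
Qed.

Lemma value_error_ge0 pi : 0 <= value_error M pi.
Proof. by rewrite /value_error /sup_norm bigmax_ge_id. Qed.

Lemma backup_opt_error pi s a :
  backup M Vo s a - backup M (value M pi) s a <= gamma * value_error M pi.
Proof.
rewrite backupB ler_wpM2l ?discount_ge0//; apply: fdist_avg_le => s'.
exact: value_error_ge.
Qed.

Variable d : S -> A.
Hypothesis backup_opt_le : forall s a, backup M Vo s a <= Vo s.
Hypothesis backup_opt_d : forall s, backup M Vo s (d s) = Vo s.
Hypothesis value_le_opt : forall pi s, value M pi s <= Vo s.
Hypothesis opt_qvalue_backup : opt_qvalue M = backup M Vo.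

(** No value exceeds the optimum, so one-sided bounds suffice; [0 <= c] covers the initial value 0
    of the maximum. *)
Lemma value_error_le pi c : 0 <= c ->
  (forall s, Vo s - value M pi s <= c) -> value_error M pi <= c.
Proof.
move=> c0 le_c; apply/bigmax_leP; split=> // s _.
by rewrite ger0_norm// subr_ge0.
Qed.

Lemma mem_opt_actions s a : (a \in opt_actions M s) = (backup M Vo s a == Vo s).
Proof.
rewrite inE /opt_advantage opt_qvalue_backup; apply/forallP/eqP => [h|h b].
  apply/le_anti; rewrite backup_opt_le/= -(backup_opt_d s).
  by move: (h (d s)); rewrite lerD2r.
by rewrite lerD2r h.
Qed.

Lemma gap_le s a : a \notin opt_actions M s -> gap M <= Vo s - backup M Vo s a.
Proof.
move=> aN; have sN : s \in nontrivial_states M.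
  by rewrite inE; apply: contraNneq aN => ->; rewrite inE.
have -> : Vo s - backup M Vo s a = `|opt_advantage M s a|.
  by rewrite /opt_advantage opt_qvalue_backup distrC ger0_norm// subr_ge0.
rewrite /gap; set g := (X in fine X).
have g_le : (g <= `|opt_advantage M s a|%:E)%E.
  apply: le_trans (bigmin_le_cond _ _ sN) _.
  exact: (bigmin_le_cond _ (fun a => `|opt_advantage M s a|%:E)%E aN).
have g_ge0 : (0 <= g)%E.
  apply/bigmin_geP; split=> [|s' _]; first exact: leey.
  by apply/bigmin_geP; split=> [|b _]; [exact: leey|rewrite lee_fin].
(* The action [a] makes the minimum finite, so [fine] does not return its default value. *)
have g_fin : g \is a fin_num.
  by rewrite ge0_fin_numE// (le_lt_trans g_le)// ltry.
by rewrite -lee_fin fineK.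
Qed.

Lemma greedy_gapP pi s :
  (greedy_actions M pi s = [set: A]%SET /\ greedy_gap M pi s = +oo%E) \/
  exists delta : R, [/\ 0 <= delta, greedy_gap M pi s = delta%:E &
    forall a b, a \in greedy_actions M pi s -> b \notin greedy_actions M pi s ->
      delta <= advantage M pi s a - advantage M pi s b].
Proof.
pose f := advantage M pi s.
have [m fm] : exists m, forall a, f a <= f m.
  case: (@Order.TotalTheory.arg_maxP _ _ _ (d s) xpredT f isT) => m _ mP.
  by exists m => a; exact: mP.
have max1 : (\big[Order.max/-oo]_a (f a)%:E = (f m)%:E)%E.
  apply/le_anti/andP; split.
    by apply/bigmax_leP; split=> [|a _]; [exact: leNye|rewrite lee_fin].
  exact: (le_bigmax _ (fun a => (f a)%:E)).
rewrite /greedy_gap -/f max1.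
have [b0 b0N|allG] := pickP (fun b => b \notin greedy_actions M pi s);
    last first.
  left; split; last by rewrite big_pred0.
  by apply/setP => b; rewrite [RHS]inE; exact/negbFE/allG.
right; rewrite (@Order.TotalTheory.bigmax_eq_arg _ _ _ -oo%E b0)//; last first.
  by move=> b _; exact: leNye.
case: (@Order.TotalTheory.arg_maxP _ _ _ b0) => // b bN bmax.
exists (f m - f b); split=> //; first by rewrite subr_ge0.
move=> a c aG cN; apply: lerB.
  by move: aG; rewrite inE => /forallP.
by rewrite -lee_fin; exact: bmax.
Qed.

Definition softmax_update (eta : R) pi (s : S) (a : A) : R :=
  pi s a * expR (eta * advantage M pi s a) /
    \sum_b pi s b * expR (eta * advantage M pi s b).

Variables (eta eps : R).
Hypothesis eta_gt0 : 0 < eta.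
Hypothesis eps_gap : eps <= gap M.
Variable pi : policy R S A.
Hypothesis pi_gt0 : forall s a, 0 < pi s a.

Local Notation err := (value_error M pi).
Local Notation adv := (advantage M pi).

(** The step estimate with [G] the set of all actions and [X = 0], where the gap condition is
    vacuous. *)
Lemma softmax_update_ge0 s : 0 <= \sum_a softmax_update eta pi s a * adv s a.
Proof.
have := softmax_step_advantage eta_gt0 (avg_advantage0 pi s) (lexx 0)
  (X := 0) (G := [set: A]%SET).
rewrite mulr0; apply; last by move=> b; rewrite inE.
under eq_bigr do rewrite sub0r mulrN.
by under eq_bigl do rewrite inE; rewrite sumrN avg_advantage0 oppr0.
Qed.

(** An optimal action has $Q^*=V^*$, and replacing $V^*$ by the current value one step later costs
    at most $\gamma$ times the error. *)
Let opt_action_advantage s a : a \in opt_actions M s ->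
  Vo s - value M pi s - gamma * err <= adv s a.
Proof.
rewrite mem_opt_actions => /eqP aopt; rewrite advantage_backup.
by have := backup_opt_error pi s a; rewrite aopt; lra.
Qed.

(** The common form in which both regimes feed the contraction; [X] is instantiated by the average
    advantage over the chosen set of actions. *)
Let step_bound s (C : \bar R) := (0 <= C)%E /\
  exists2 X, Vo s - value M pi s - gamma * err <= X &
    (1 - fine (1 + C)^-1%E) * X <= \sum_a softmax_update eta pi s a * adv s a.

Let opt_state_constant s : err <= eps ->
  step_bound s (state_constant M eta eps pi s).
Proof.
move=> err_eps; rewrite /step_bound /state_constant ltNge err_eps/=.
set G := opt_actions M s; pose q := \sum_(a in G) pi s a.
have -> : 1 - subopt_mass M pi s = q.
  by rewrite -(fdist_sum1 (pi s)) (bigID (mem G))/= addrK.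
have dG : d s \in G by rewrite mem_opt_actions backup_opt_d.
have q0 : 0 < q.
  rewrite /q (bigD1 (d s))//= ltr_pwDl ?pi_gt0//.
  by apply: sumr_ge0 => a _; exact: fdist_ge0.
pose X := (\sum_(a in G) pi s a * adv s a) / q.
have le_avg c : (forall a, a \in G -> c <= adv s a) -> c <= X.
  move=> c_le; rewrite ler_pdivlMr// mulrC mulr_suml.
  by apply: ler_sum => a /c_le; rewrite ler_pM2l.
have delta_ge0 : 0 <= gap M - eps by rewrite subr_ge0.
have C0 : 0 <= q * (expR (eta * (gap M - eps)) - 1).
  rewrite mulr_ge0 ?(ltW q0)// subr_ge0 -expR0 ler_expR mulr_ge0//.
  exact: ltW.
split; first by rewrite lee_fin.
exists X; first by apply: le_avg => a; exact: opt_action_advantage.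
rewrite -EFinD /inve gt_eqF/= ?ltr_pwDl//.
apply: softmax_step_advantage => //.
- exact: avg_advantage0.
- under eq_bigr do rewrite mulrBr.
  by rewrite sumrB -mulr_suml -/q /X mulrC divfK ?gt_eqF// subrr.
(* On [G] the advantage is at least $V^*-V-\gamma\,$[err]; at [b] it is at most $V^*-V-\Delta$. They
   differ by at least $\Delta-\gamma\,$[err], hence by $\Delta-\varepsilon$. *)
- move=> b bG; rewrite lerBrDr; apply: le_avg => a aG.
  have := opt_action_advantage aG; have := gap_le bG.
  have : backup M (value M pi) s b <= backup M Vo s b.
    by apply: le_backup => s'; exact: value_le_opt.
  have : gamma * err <= err.
    by rewrite ler_piMl ?value_error_ge0// ltW// discount_lt1.
  rewrite (advantage_backup pi s b); move: err_eps; lra.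
Qed.

Let greedy_state_constant s : eps < err ->
  step_bound s (state_constant M eta eps pi s).
Proof.
move=> err_eps; rewrite /step_bound /state_constant err_eps.
set G := greedy_actions M pi s.
have [m mG] : exists m, m \in G.
  case: (@Order.TotalTheory.arg_maxP _ _ _ (d s) xpredT (adv s) isT) => m _ mP.
  by exists m; rewrite inE; apply/forallP => a; exact: mP.
have m_max a : adv s a <= adv s m by move: mG; rewrite inE => /forallP.
have avgG : \sum_(a in G) pi s a * (adv s m - adv s a) = 0.
  apply: big1 => a; rewrite inE => /forallP/(_ m) am.
  by rewrite (@le_anti _ _ (adv s a) (adv s m)) ?subrr ?mulr0// m_max.
have X_ge : Vo s - value M pi s - gamma * err <= adv s m.
  apply: le_trans (m_max (d s)); apply: opt_action_advantage.
  by rewrite mem_opt_actions backup_opt_d.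
have [[GT ->]|[delta [delta0 -> deltaG]]] := greedy_gapP pi s.
  have -> : greedy_mass M pi s = 1.
    rewrite /greedy_mass GT -(fdist_sum1 (pi s)).
    by apply: eq_bigl => a; rewrite inE.
  (* Mass 1 makes the product $+\infty$, so its inverse term is 0 and [X] itself must be a lower
     bound. Every advantage equals the maximum, which is thus at most their average 0. *)
  rewrite gt0_muley ?lte_fin//= mul1e; split; first exact: leey.
  exists (adv s m) => //; rewrite addey// /inve/= subr0 mul1r.
  apply: le_trans (softmax_update_ge0 s).
  rewrite -(avg_advantage0 pi s); apply: fdist_avg_ge => a.
  by have : a \in G; [rewrite /G GT inE|rewrite inE => /forallP].
have -> : ((greedy_mass M pi s)%:E * (expeR (eta%:E * delta%:E) - 1))%E =
  (greedy_mass M pi s * (expR (eta * delta) - 1))%:E by [].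
have C0 : 0 <= greedy_mass M pi s * (expR (eta * delta) - 1).
  rewrite mulr_ge0 ?sumr_ge0// => [a _|]; first exact: fdist_ge0.
  by rewrite subr_ge0 -expR0 ler_expR mulr_ge0// ltW.
split; first by rewrite lee_fin.
exists (adv s m) => //.
rewrite -EFinD /inve gt_eqF/= ?ltr_pwDl//.
apply: softmax_step_advantage => //; first exact: avg_advantage0.
by move=> b; exact: deltaG.
Qed.

Let state_constant_spec s :
  step_bound s (state_constant M eta eps pi s).
Proof.
by have [/opt_state_constant|/greedy_state_constant] := leP err eps; apply.
Qed.

Lemma npg_constant_ge0 : (0 <= npg_constant M eta eps pi)%E.
Proof.
apply/bigmin_geP; split=> [|s _]; first exact: leey.
by have [] := state_constant_spec s.
Qed.

Lemma npg_step_error (pi' : policy R S A) :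
  (forall s a, pi' s a = softmax_update eta pi s a) ->
  value_error M pi' <= err * npg_rate M (npg_constant M eta eps pi).
Proof.
move=> pi'E; have err0 := value_error_ge0 pi.
have C0 := npg_constant_ge0.
apply: value_error_le; first by rewrite mulr_ge0 ?npg_rate_ge0.
move=> s; set V := value M pi.
have stepE s' : \sum_a pi' s' a * backup M V s' a =
    V s' + \sum_a softmax_update eta pi s' a * adv s' a.
  under [X in _ = _ + X]eq_bigr do rewrite -pi'E advantage_backup mulrBr.
  by rewrite sumrB -mulr_suml fdist_sum1 mul1r addrC subrK.
(* Policy improvement: the average advantage of the update is nonnegative, so [V] is a subsolution
   for [pi']. *)
have VV' : forall s', V s' <= value M pi' s'.
  apply: le_value => s'; rewrite stepE lerDl; exact: softmax_update_ge0.
have V'T : V s + \sum_a softmax_update eta pi s a * adv s a <= value M pi' s.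
  rewrite -stepE [leRHS]value_backup; apply: ler_sum => a _.
  by rewrite ler_wpM2l ?fdist_ge0// le_backup.
have [Cs0 [X leX Xle]] := state_constant_spec s.
have rate_le : npg_rate M (state_constant M eta eps pi s) <=
    npg_rate M (npg_constant M eta eps pi).
  by rewrite npg_rate_anti//; exact: bigmin_le.
apply: le_trans (ler_wpM2l err0 rate_le).
move: Xle (fine_inv1D_bounds Cs0); rewrite /npg_rate.
set i := fine _ => Xle /andP[i0 i1].
(* The new error at [s] is at most $i(V^*-V)+(1-i)\gamma\,$[err], and
   $i+(1-i)\gamma=1-(1-\gamma)(1-i)$ is the rate. *)
have : (1 - i) * (Vo s - V s - gamma * err) <= (1 - i) * X.
  by rewrite ler_wpM2l// subr_ge0.
have : i * (Vo s - V s) <= i * err by rewrite ler_wpM2l// value_error_ge.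
nra.
Qed.

End npg_step.

(** * Iteration of the one-step bound *)

Theorem theorem5p4 (R : realType) (S A : finType) (M : mdp R S A)
    (eta eps : R) (pi : nat -> policy R S A) :
  nontrivial_states M != finset.set0 ->
  0 < eta ->
  softmax_npg M eta pi ->
  0 < eps < gap M / 2 ->
  forall k : nat,
    value_error M (pi k) <=
      value_error M (pi 0%N) *
        \prod_(0 <= t < k) npg_rate M (npg_constant M eta eps (pi t))
    /\
    value_error M (pi 0%N) *
        \prod_(0 <= t < k) npg_rate M (npg_constant M eta eps (pi t)) <=
      value_error M (pi 0%N) *
        npg_rate M (ereal_inf (range (fun t =>
          npg_constant M eta eps (pi t)))) ^+ k.
Proof.
move=> /set0Pn[s0 s0N] eta_gt0 [pi0_gt0 piS] /andP[eps_gt0 eps_lt] k.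
(* A nontrivial state has a suboptimal action, so the action space is inhabited and an optimal
   policy exists. *)
have [a0 _|opt_all] := pickP (fun a => a \notin opt_actions M s0); last first.
  move: s0N; rewrite inE => /eqP[]; apply/setP => a; rewrite [RHS]inE.
  exact/negbFE/opt_all.
have [d [backup_le backup_d value_le QE]] := exists_optimal_policy M a0.
have eps_gap : eps <= gap M by lra.
have pi_gt0 t s a : 0 < pi t s a.
  elim: t s a => [//|t IHt] s a; rewrite piS divr_gt0 ?mulr_gt0 ?expR_gt0//.
  apply: lt_le_trans (softmax_normalizer_ge1 eta (avg_advantage0 M (pi t) s)).
  exact: ltr01.
have C0 t : (0 <= npg_constant M eta eps (pi t))%E.
  exact: (npg_constant_ge0 backup_le backup_d value_le QE eta_gt0 eps_gap
    (pi_gt0 t)).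
split.
  elim: k => [|k IHk]; first by rewrite big_geq// mulr1.
  rewrite big_nat_recr//= mulrA.
  apply: le_trans (ler_wpM2r (npg_rate_ge0 M (C0 k)) IHk).
  exact: (npg_step_error backup_le backup_d value_le QE eta_gt0 eps_gap
    (pi_gt0 k) (piS k)).
(* The power is a product of [k] equal factors. The infimum is a nonnegative lower bound of the
   constants and the rate is antitone, so the products compare factor by factor. *)
rewrite ler_wpM2l ?value_error_ge0// -[X in _ ^+ X](card_ord k) -prodr_const.
rewrite big_mkord; apply: ler_prod => t _; rewrite npg_rate_ge0//=.
rewrite npg_rate_anti//; first by apply: le_ereal_inf_tmp => _ [u _ <-].
by apply: ereal_inf_lbound; exists t.
Qed.
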